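(* Let $[A]$ be an interval matrix of size $n\times n$ and let $K\in\mathbb{N}$ be such that $K+2>\|[A]\|$. Then $$\{\exp(A):A\in[A]\}\subseteq[\mathcal{H}]([A],K).$$
   Context: Interval: a set $[x]=[\underline{x},\overline{x}]=\{x\in\mathbb{R}:\underline{x}\le x\le\overline{x}\}$ with real $\underline{x}\le\overline{x}$; a real number $x$ is identified with $[x,x]$. Interval arithmetic (exact, no rounding): for $\circ\in\{+,-,\times,\div\}$, $[x]\circ[y]=\{x\circ y:x\in[x],y\in[y]\}$ (for division, $0\notin[y]$). An $n\times n$ interval matrix is $[A]=\{A\in\mathbb{R}^{n\times n}:\underline{A}\le A\le\overline{A}\}$ for real matrices $\underline{A}\le\overline{A}$ (entrywise), equivalently a matrix of intervals $([a_{ij}])$ with $[a_{ij}]=[\underline{a}_{ij},\overline{a}_{ij}]$; a real matrix is identified with a degenerate interval matrix. Sums of interval matrices and products or quotients by scalars or intervals are entrywise, and the product is $([A][B])_{ij}=\sum_k[a_{ik}][b_{kj}]$, all in interval arithmetic. $\|\cdot\|$ is the infinity norm (maximum absolute row sum) for real matrices, and $\|[A]\|=\max\{\|A\|:A\in[A]\}$, which equals $\|\,|[A]|\,\|$ where $|[A]|$ is the real matrix with entries $\max\{|\underline{a}_{ij}|,|\overline{a}_{ij}|\}$. For $K+2>\|[A]\|$ define, with $I$ the identity matrix and $E\in\mathbb{R}^{n\times n}$ the matrix with all entries equal to $1$, $$[\mathcal{R}]([A],K)=\rho(\|[A]\|,K)\,[-E,E],\qquad \rho(\alpha,K)=\frac{\alpha^{K+1}}{(K+1)!\,\bigl(1-\frac{\alpha}{K+2}\bigr)},$$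 $$[\tilde{\mathcal{H}}]([A],K)=I+[A]\Bigl(I+\tfrac{[A]}{2}\Bigl(I+\tfrac{[A]}{3}\Bigl(\cdots\Bigl(I+\tfrac{[A]}{K}\Bigr)\cdots\Bigr)\Bigr)\Bigr),$$ evaluated in interval arithmetic in the nested order displayed (for $K=0$ it is read as $I$), and $$[\mathcal{H}]([A],K)=[\tilde{\mathcal{H}}]([A],K)+[\mathcal{R}]([A],K).$$ *)

(* Defs.v *)
From mathcomp Require Import all_boot all_order all_algebra.
From mathcomp Require Import all_classical all_reals all_analysis.
Set Implicit Arguments.
Unset Strict Implicit.
Unset Printing Implicit Defensive.
Import Order.TTheory GRing.Theory Num.Theory.
Import numFieldNormedType.Exports.
Local Open Scope classical_set_scope.
Local Open Scope ring_scope.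

Section IntervalArithmetic.
Variable R : realType.
Implicit Types X Y : set R.

Definition iadd X Y : set R := [set x + y | x in X & y in Y].
Definition imul X Y : set R := [set x * y | x in X & y in Y].
(* Only meaningful when 0 is not in Y, since x / 0 = 0 here. *)
Definition idiv X Y : set R := [set x / y | x in X & y in Y].

End IntervalArithmetic.

Section IntervalMatrices.
Variables (R : realType) (n : nat).
Implicit Types (A lo hi : 'M[R]_n) (X Y : 'M[set R]_n).

(* Interval matrices are represented as matrices of subsets of R. *)
Definition imx lo hi : 'M[set R]_n :=
  \matrix_(i, j) [set` `[lo i j, hi i j]].

Definition imx_real A : 'M[set R]_n := \matrix_(i, j) [set A i j].

(* The set of real matrices denoted by an interval matrix. *)
Definition imx_set X : set 'M[R]_n := [set A | forall i j, X i j (A i j)].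

Definition imxD X Y : 'M[set R]_n := \matrix_(i, j) iadd (X i j) (Y i j).

Definition imxM X Y : 'M[set R]_n :=
  \matrix_(i, j) \big[@iadd R/[set 0]]_(k < n) imul (X i k) (Y k j).

(* Scalars are identified with degenerate intervals. *)
Definition imxZ (c : R) X : 'M[set R]_n := \matrix_(i, j) imul [set c] (X i j).
Definition imx_div X (c : R) : 'M[set R]_n :=
  \matrix_(i, j) idiv (X i j) [set c].

Definition infnorm A : R := \big[Num.max/0]_(i < n) \sum_(j < n) `|A i j|.

(* The supremum is a maximum whenever X is given by nonempty compact
   intervals. *)
Definition imxnorm X : R := sup [set infnorm A | A in imx_set X].

Definition mexp A : 'M[R]_n :=
  lim (series (fun k => (k`!%:R)^-1 *: A ^+ k) @ \oo).

Definition rho (a : R) (K : nat) : R :=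
  a ^+ K.+1 / ((K.+1)`!%:R * (1 - a / K.+2%:R)).

Definition iremainder X (K : nat) : 'M[set R]_n :=
  imxZ (rho (imxnorm X) K) (imx (- const_mx 1) (const_mx 1)).

(* ihorner_from X k m is
   I + X/k (I + X/(k+1) ( ... (I + X/(k+m)) ... )). *)
Fixpoint ihorner_from X (k m : nat) : 'M[set R]_n :=
  match m with
  | 0%N => imxD (imx_real 1%:M) (imx_div X k%:R)
  | m'.+1 => imxD (imx_real 1%:M)
               (imxM (imx_div X k%:R) (ihorner_from X k.+1 m'))
  end.

Definition ihorner X (K : nat) : 'M[set R]_n :=
  match K with
  | 0%N => imx_real 1%:M
  | 1%N => imxD (imx_real 1%:M) X
  | K'.+2 => imxD (imx_real 1%:M) (imxM X (ihorner_from X 2 K'))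
  end.

Definition iexp_enclosure X (K : nat) : 'M[set R]_n :=
  imxD (ihorner X K) (iremainder X K).

End IntervalMatrices.

(* Main.v *)
(* Interval evaluation of the Horner scheme contains its value at any A in [A],
   which is the Taylor polynomial of exp(A) of degree K.  Writing a = ||A||, each
   entry of the Taylor remainder is at most the scalar tail
   sum_(k > K) a^k / k!; since a^(K+1+j) / (K+1+j)! is at most
   a^(K+1) / (K+1)! * (a / (K+2))^j, a geometric series bounds this tail by
   rho(a, K), and rho is nondecreasing in a. *)
From HB Require Import structures.
Require Import Defs.
From mathcomp Require Import all_boot all_order all_algebra.
From mathcomp Require Import all_classical all_reals all_analysis.
Import Order.TTheory GRing.Theory Num.Theory.
Import numFieldNormedType.Exports.
Local Open Scope classical_set_scope.
Local Open Scope ring_scope.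

Set Implicit Arguments.
Unset Strict Implicit.

Section Infnorm.
Variables (R : realType) (n : nat).
Implicit Types A B : 'M[R]_n.

Lemma infnorm_ge0 A : 0 <= infnorm A.
Proof. by apply/bigmax_geP; left. Qed.

Lemma row_sum_le_infnorm A i : \sum_(j < n) `|A i j| <= infnorm A.
Proof. exact: (le_bigmax _ (fun i => \sum_(j < n) `|A i j|)). Qed.

Lemma entry_le_infnorm A i j : `|A i j| <= infnorm A.
Proof.
apply: le_trans (row_sum_le_infnorm A i).
by rewrite (bigD1 j) //= lerDl sumr_ge0.
Qed.

Lemma infnorm_le A c : 0 <= c ->
  (forall i, \sum_(j < n) `|A i j| <= c) -> infnorm A <= c.
Proof. by move=> c0 Ac; apply/bigmax_leP; split. Qed.

Lemma infnormM A B : infnorm (A *m B) <= infnorm A * infnorm B.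
Proof.
apply: infnorm_le => [|i]; first by rewrite mulr_ge0 ?infnorm_ge0.
apply: (@le_trans _ _ (\sum_k `|A i k| * \sum_j `|B k j|)).
  under [leRHS]eq_bigr do rewrite mulr_sumr.
  rewrite exchange_big; apply: ler_sum => j _; rewrite mxE.
  apply: le_trans (ler_norm_sum _ _ _) _.
  by apply: ler_sum => k _; rewrite normrM.
apply: le_trans (ler_wpM2r (infnorm_ge0 B) (row_sum_le_infnorm A i)).
rewrite mulr_suml; apply: ler_sum => k _.
by apply: ler_wpM2l => //; exact: row_sum_le_infnorm.
Qed.

(** Only an inequality, because for [n = 0] the maximum over no rows is 0. *)
Lemma infnorm1 : infnorm (1%:M : 'M[R]_n) <= 1.
Proof.
apply: infnorm_le => // i; rewrite (bigD1 i) //= big1 => [|j /negPf ji].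
  by rewrite mxE eqxx normr1 addr0.
by rewrite mxE eq_sym ji normr0.
Qed.

Lemma infnormX A k : infnorm (A ^+ k) <= infnorm A ^+ k.
Proof.
elim: k => [|k IH]; first by rewrite !expr0 infnorm1.
rewrite !exprS; apply: le_trans (infnormM _ _) _.
by rewrite ler_wpM2l ?infnorm_ge0.
Qed.

End Infnorm.

(* The library has both the norm and the completeness of matrices, but not
   their join. *)
HB.instance Definition _ (R : realType) (n : nat) := Complete.on 'M[R]_n.

Section Exponential.
Variables (R : realType) (n : nat).
Implicit Types A : 'M[R]_n.

(** Domination by the scalar exponential series, used both for convergence and for the tail bound;
    it rests on submultiplicativity of [infnorm]. *)
Lemma norm_exp_term_le A k i j :
  `|(k`!%:R^-1 *: A ^+ k) i j| <= exp_coeff (infnorm A) k.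
Proof.
rewrite mxE normrM ger0_norm ?invr_ge0 // mulrC /exp_coeff /=.
rewrite ler_wpM2r ?invr_ge0 //.
exact: le_trans (entry_le_infnorm _ _ _) (infnormX _ _).
Qed.

(** Since [mexp] is a bare [lim], convergence has to be proved. It follows from absolute convergence
    in the complete space of matrices, whose norm is the largest absolute entry rather than
    [infnorm]. *)
Lemma mexp_cvg A : series (fun k => k`!%:R^-1 *: A ^+ k) @ \oo --> mexp A.
Proof.
apply: normed_cvg.
apply: series_le_cvg (is_cvg_series_exp_coeff (infnorm A)) => [k|k|k] /=.
- by rewrite normr_ge0.
- by rewrite /exp_coeff /= divr_ge0 ?exprn_ge0 ?infnorm_ge0.
rewrite [leLHS]mx_normrE; apply/bigmax_leP; split => [|[i j] _] /=.
  by rewrite divr_ge0 ?exprn_ge0 ?infnorm_ge0.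
exact: norm_exp_term_le.
Qed.

Lemma exp_coeff_tail_le (a : R) K m : 0 <= a -> a < K.+2%:R ->
  \sum_(k < m) exp_coeff a (K.+1 + k)%N <= rho a K.
Proof.
move=> a0 aK; pose q := a / K.+2%:R; pose c := a ^+ K.+1 / K.+1`!%:R.
have q0 : 0 <= q by rewrite divr_ge0.
have q1 : 0 < 1 - q by rewrite subr_gt0 ltr_pdivrMr ?mul1r ?ltr0n.
have c0 : 0 <= c by rewrite divr_ge0 ?exprn_ge0.
(* Consecutive terms have ratio a / (K + 2 + k), which is at most q. *)
have term_le k : exp_coeff a (K.+1 + k)%N <= c * q ^+ k.
  elim: k => [|k IH]; first by rewrite addn0 expr0 mulr1.
  rewrite addnS exprSr mulrA.
  have -> : exp_coeff a (K.+1 + k)%N.+1 =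
            exp_coeff a (K.+1 + k)%N * (a / (K.+1 + k)%N.+1%:R).
    by rewrite /exp_coeff /= exprSr factS natrM invfM [X in _ * X]mulrC mulrACA.
  have e0 : 0 <= exp_coeff a (K.+1 + k)%N by rewrite /exp_coeff /= divr_ge0 ?exprn_ge0.
  apply: ler_pM => //; first by rewrite divr_ge0.
  by rewrite ler_wpM2l // lef_pV2 ?posrE ?ltr0n // ler_nat addSn ltnS ltnS leq_addr.
have -> : rho a K = c / (1 - q) by rewrite /rho invfM mulrA.
apply: (@le_trans _ _ (\sum_(k < m) c * q ^+ k)); first by apply: ler_sum.
(* Uses (1 - q) times the sum of q^k over k < m, which equals 1 - q^m. *)
rewrite -mulr_sumr ler_wpM2l // -[leRHS]mul1r ler_pdivlMr //.
by rewrite mulrC -opprB mulNr -subrX1 opprB gerBl exprn_ge0.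
Qed.

Lemma mexp_remainder_le A K i j : infnorm A < K.+2%:R ->
  `|mexp A i j - (\sum_(k < K.+1) k`!%:R^-1 *: A ^+ k) i j|
    <= rho (infnorm A) K.
Proof.
move=> AK; set s := fun_of_matrix (\sum_(_ < _) _) i j.
have cvgij : (fun N => series (fun k => k`!%:R^-1 *: A ^+ k) N i j) @ \oo
    --> mexp A i j.
  exact: (cvg_comp _ _ (@mexp_cvg A) (@coord_continuous R n n i j (mexp A))).
have /cvg_norm cvgn : (fun N =>
    series (fun k => k`!%:R^-1 *: A ^+ k) N i j - s) @ \oo --> mexp A i j - s.
  by apply: cvgB => //; exact: cvg_cst.
rewrite -(cvg_lim (@Rhausdorff R) cvgn); apply: limr_le.
  by apply/cvg_ex; exists `|mexp A i j - s|.
(* The N-th partial sum has the indices below N, so for N > K it contains the whole Taylor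
   polynomial, and a finite tail is left. *)
exists K.+1 => // N /= KN; rewrite seriesEord /= -(subnKC KN) big_split_ord /=.
rewrite mxE addrAC subrr add0r summxE.
apply: le_trans (exp_coeff_tail_le (N - K.+1) (infnorm_ge0 A) AK).
apply: le_trans (ler_norm_sum _ _ _) _; apply: ler_sum => k _.
exact: norm_exp_term_le.
Qed.

End Exponential.

Section Inclusion.
Variables (R : realType) (n : nat).
Implicit Types (A B : 'M[R]_n) (X Y : 'M[set R]_n).

Lemma imx_realP A : imx_set (imx_real A) A.
Proof. by move=> i j; rewrite mxE. Qed.

Lemma imxDP X Y A B :
  imx_set X A -> imx_set Y B -> imx_set (imxD X Y) (A + B).
Proof. by move=> XA YB i j; rewrite !mxE; exists (A i j) => //; exists (B i j). Qed.

Lemma imxMP X Y A B :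
  imx_set X A -> imx_set Y B -> imx_set (imxM X Y) (A *m B).
Proof.
move=> XA YB i j; rewrite !mxE.
apply: (big_rec2 (fun (S : set R) x => S x)) => // k S x _ Sx.
exists (A i k * B k j); last by exists x.
by exists (A i k) => //; exists (B k j).
Qed.

Lemma imx_divP X A (c : R) :
  imx_set X A -> imx_set (imx_div X c) (c^-1 *: A).
Proof.
by move=> XA i j; rewrite !mxE mulrC; exists (A i j) => //; exists c.
Qed.

(** The factor k! normalises the constant term to I. The induction generalises k, as each nesting
    level raises the first divisor by one; there are m + 2 terms because the innermost level is
    already linear in A. *)
Lemma ihorner_from_taylor X A k m : imx_set X A ->
  imx_set (ihorner_from X k.+1 m)
    (\sum_(j < m.+2) (k`!%:R / (k + j)%N`!%:R) *: A ^+ j).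
Proof.
move=> XA; elim: m k => [|m IH] k.
  rewrite !big_ord_recl big_ord0 addr0 /= addn0 divff ?pnatr_eq0 -?lt0n ?fact_gt0 //.
  rewrite expr0 scale1r expr1 addn1 factS natrM invfM mulrCA divff ?mulr1;
    last by rewrite pnatr_eq0 -lt0n fact_gt0.
  by apply: imxDP; [exact: imx_realP | exact: imx_divP].
rewrite big_ord_recl /= addn0 divff ?pnatr_eq0 -?lt0n ?fact_gt0 // expr0 scale1r.
apply: imxDP; first exact: imx_realP.
have -> : \sum_(j < m.+2) (k`!%:R / (k + bump 0 j)%N`!%:R) *: A ^+ bump 0 j =
    (k.+1%:R^-1 *: A) *m
      \sum_(j < m.+2) (k.+1`!%:R / (k.+1 + j)%N`!%:R) *: A ^+ j.
  rewrite mulmx_sumr; apply: eq_bigr => j _.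
  rewrite -scalemxAl -scalemxAr scalerA /bump add1n addnS addSn exprS.
  by rewrite (factS k) natrM -mulrA mulKf ?pnatr_eq0.
exact: imxMP (imx_divP _ XA) (IH _).
Qed.

Lemma ihorner_taylor X A K : imx_set X A ->
  imx_set (ihorner X K) (\sum_(k < K.+1) k`!%:R^-1 *: A ^+ k).
Proof.
move=> XA; rewrite big_ord_recl /= fact0 invr1 scale1r expr0.
case: K => [|[|K]] /=.
- by rewrite big_ord0 addr0; exact: imx_realP.
- rewrite big_ord1 /= expr1 invr1 scale1r.
  by apply: imxDP => //; exact: imx_realP.
apply: imxDP; first exact: imx_realP.
(* The outermost factor A carries no divisor, so the inner scheme starts at divisor 2, that is, at k
   = 1. *)
have -> : \sum_(i < K.+2) (bump 0 i)`!%:R^-1 *: A ^+ bump 0 i =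
    A *m \sum_(j < K.+2) (1`!%:R / (1 + j)%N`!%:R) *: A ^+ j.
  rewrite mulmx_sumr; apply: eq_bigr => j _.
  by rewrite -scalemxAr mul1r exprS.
exact: imxMP (ihorner_from_taylor _ _ XA).
Qed.

Lemma iremainderP X K B : (forall i j, `|B i j| <= rho (imxnorm X) K) ->
  imx_set (iremainder X K) B.
Proof.
move=> Br i j; rewrite !mxE; set r := rho _ _ in Br *.
(* If r = 0, then B i j = 0 and the quotient is 0 by convention, so the same witness lies in
   [-1, 1]. *)
exists r => //; exists (B i j / r).
  have r0 : 0 <= r by exact: le_trans (Br i j).
  rewrite /= in_itv /= -ler_norml normrM normfV (ger0_norm r0).
  have [->|rn0] := eqVneq r 0; first by rewrite invr0 mulr0.
  by rewrite ler_pdivrMr ?mul1r ?lt_neqAle 1?eq_sym ?rn0.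
have [r0|rn0] := eqVneq r 0; last by rewrite mulrC divfK.
by rewrite r0 mul0r; apply/esym/eqP; rewrite -normr_le0 -r0.
Qed.

Lemma infnorm_le_imxnorm (lo hi A : 'M[R]_n) :
  imx_set (imx lo hi) A -> infnorm A <= imxnorm (imx lo hi).
Proof.
move=> XA; apply: sup_upper_bound; last by exists A.
split; first by exists (infnorm A), A.
(* For [sup] to be an upper bound the set must be bounded; |lo| + |hi| dominates every member
   entrywise. *)
exists (infnorm (\matrix_(i, j) (`|lo i j| + `|hi i j|))) => _ [B XB <-].
apply: infnorm_le => [|i]; first exact: infnorm_ge0.
apply: le_trans (row_sum_le_infnorm _ i); apply: ler_sum => j _.
have := XB i j; rewrite !mxE /= in_itv /= => /andP[loB Bhi].
rewrite [leRHS]ger0_norm ?addr_ge0 // ler_norml; apply/andP; split.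
  apply: le_trans loB; rewrite lerNl; apply: le_trans (ler_norm _) _.
  by rewrite normrN lerDl.
by apply: le_trans Bhi _; apply: le_trans (ler_norm _) _; rewrite lerDr.
Qed.

End Inclusion.

(** Passes from the norm of one A to that of the interval matrix. The numerator grows with a, while
    the denominator shrinks but stays positive below K + 2. *)
Lemma ler_rho (R : realType) (a b : R) K :
  0 <= a -> a <= b -> b < K.+2%:R -> rho a K <= rho b K.
Proof.
move=> a0 ab bK; rewrite /rho.
have K0 : 0 < K.+2%:R :> R by rewrite ltr0n.
have q0 c : c < K.+2%:R -> 0 < 1 - c / K.+2%:R :> R.
  by move=> cK; rewrite subr_gt0 ltr_pdivrMr ?mul1r.
have f0 : 0 < K.+1`!%:R :> R by rewrite ltr0n fact_gt0.
have aK := le_lt_trans ab bK.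
apply: ler_pM.
- by rewrite exprn_ge0.
- by rewrite invr_ge0 mulr_ge0 // ltW // q0.
- by rewrite lerXn2r // nnegrE (le_trans a0).
rewrite lef_pV2 ?posrE ?mulr_gt0 ?q0 // ler_pM2l // lerB //.
by rewrite ler_pM2r ?invr_gt0.
Qed.

Unset Implicit Arguments.
Set Strict Implicit.

Theorem theorem4 (R : realType) (n : nat) (lo hi : 'M[R]_n) (K : nat)
    (hlohi : forall i j, lo i j <= hi i j)
    (hK : imxnorm (imx lo hi) < (K + 2)%:R) :
  [set mexp A | A in imx_set (imx lo hi)]
    `<=` imx_set (iexp_enclosure (imx lo hi) K).
Proof.
rewrite addn2 in hK => _ [A XA <-].
pose S := \sum_(k < K.+1) k`!%:R^-1 *: A ^+ k.
(* Splits exp(A) as S + (exp(A) - S), matching the two summands of the enclosure. *)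
rewrite -[mexp A](subrKC S); apply: imxDP; first exact: ihorner_taylor.
have AX := infnorm_le_imxnorm XA.
apply: iremainderP => i j; rewrite mxE [X in _ + X]mxE.
apply: le_trans (mexp_remainder_le _ _ (le_lt_trans AX hK)) _.
exact: ler_rho (infnorm_ge0 _) AX hK.
Qed.
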